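(* A minimal weak link $(G,s,t)$ has at most one articulation vertex (cut-vertex) in $G$.
   Context: A Shannon game (link) $(G,s,t)$ consists of a finite simple graph $G$ and two distinct designated vertices $s,t$, the terminals. Two players, Short and Cut, alternately select a not-yet-selected non-terminal vertex; Short claims his vertices, Cut deletes his. Short wins if at the end there is an $s$–$t$ path all of whose internal vertices are claimed by Short; otherwise Cut wins. The link is strong if Short has a winning strategy when moving second, and weak if Short has a winning strategy when moving first but not when moving second. A weak link is minimal if deleting any single edge of $G$ produces a game in which Short has no winning strategy as first player. *)

(* Defs.v *)
From mathcomp Require Import all_boot.
Set Implicit Arguments.
Unset Strict Implicit.
Unset Printing Implicit Defensive.

(* A simple graph on V is a symmetric irreflexive relation E; these two
   properties are hypotheses of the theorem that uses the definitions below. *)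

Section Graph.
Variables (V : finType) (E : rel V).

Definition del_edge (x y : V) : rel V :=
  [rel u v | E u v && ([set u; v] != [set x; y])].

Definition del_vertex (v : V) : rel V :=
  [rel x y | [&& x != v, y != v & E x y]].

(* Deleting v increases the number of connected components. The relation
   [del_vertex v] still lives on V, with v isolated, so the components of the
   graph minus v are counted on [predC1 v]. *)
Definition articulation (v : V) : bool :=
  n_comp E predT < n_comp (del_vertex v) (predC1 v).

End Graph.

Section ShannonGame.
Variables (V : finType) (E : rel V) (s t : V).

(* A history lists the vertices selected so far, by either player, in
   chronological order. *)
Definition history (h : seq V) : bool :=
  [&& uniq h, s \notin h & t \notin h].

Definition complete_play (p : seq V) : bool :=
  history p && [forall v, [|| v == s, v == t | v \in p]].

(* Moves are numbered from 0; [first] tells whether Short makes move 0. *)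
Definition short_turn (first : bool) (i : nat) : bool := odd i (+) first.

Definition claimed (first : bool) (p : seq V) : {set V} :=
  [set v in p | short_turn first (index v p)].

Definition short_wins_play (first : bool) (p : seq V) : Prop :=
  exists q : seq V,
    [/\ path E s (rcons q t), uniq (s :: rcons q t)
      & {subset q <= claimed first p}].

Definition legal_strategy (first : bool) (sigma : seq V -> V) : Prop :=
  forall h : seq V, history h -> ~~ complete_play h ->
    short_turn first (size h) -> history (rcons h (sigma h)).

Definition follows (first : bool) (sigma : seq V -> V) (p : seq V) : Prop :=
  forall i : nat, i < size p -> short_turn first i ->
    nth s p i = sigma (take i p).

Definition short_has_winning_strategy (first : bool) : Prop :=
  exists sigma : seq V -> V, legal_strategy first sigma /\
    forall p : seq V, complete_play p -> follows first sigma p ->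
      short_wins_play first p.

Definition strong_link : Prop := short_has_winning_strategy false.

Definition weak_link : Prop :=
  short_has_winning_strategy true /\ ~ strong_link.

End ShannonGame.

Definition minimal_weak_link (V : finType) (E : rel V) (s t : V) : Prop :=
  weak_link E s t /\
  forall x y : V, E x y -> ~ short_has_winning_strategy (del_edge E x y) s t true.

(* Main.v *)
(* An edge vu lies on no simple s-t path as soon as the component of u in G - v
   contains neither terminal, and deleting such an edge does not hurt Short.  So
   in a minimal weak link every component of G - v adjacent to v contains s or t;
   if v is an articulation vertex there are at least two such components, hence
   v is not a terminal and separates s from t.  Against two separating vertices,
   Short can take only one of them with his first move and Cut takes the other. *)
Require Import Defs.
From mathcomp Require Import all_boot.
Set Implicit Arguments.
Unset Strict Implicit.
Unset Printing Implicit Defensive.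

Section Graph.
Variables (V : finType) (E : rel V).
Hypothesis E_sym : symmetric E.

Lemma del_vertex_sym v : symmetric (del_vertex E v).
Proof. by move=> x y; rewrite /del_vertex /= E_sym andbCA. Qed.

Lemma path_del_vertex v x p :
  v \notin x :: p -> path E x p -> path (del_vertex E v) x p.
Proof.
elim: p x => //= y p IHp x; rewrite !inE !negb_or => /and3P[xv yv vp].
case/andP=> Exy Ep; rewrite {1}/del_vertex /= Exy !(eq_sym _ v) xv yv /=.
by apply: IHp => //; rewrite inE negb_or yv.
Qed.

Lemma connect_del_vertex_neq v x y :
  x != v -> connect (del_vertex E v) x y -> y != v.
Proof.
move=> xv /connectP[p]; elim: p x xv => [|z p IHp] x xv /=.
  by move=> _ ->.
by case/andP=> /and3P[_ zv _]; apply: IHp.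
Qed.

(** Walk from x towards y and stop just before the first visit to v: either v is never met, or the
    walk has stopped at a neighbour of v. *)
Lemma connect_del_vertexVneighbour v x y :
    x != v -> connect E x y ->
  connect (del_vertex E v) x y \/
  exists2 u, E v u & connect (del_vertex E v) x u.
Proof.
move=> xv /connectP[p Ep ->]; elim: p x xv Ep => [|z p IHp] x xv /=.
  by left; apply: connect0.
case/andP=> Exz Ep; have [zv|zv] := eqVneq z v.
  by right; exists x; rewrite ?connect0 // E_sym -zv.
have Dxz : connect (del_vertex E v) x z.
  by apply: connect1; rewrite /del_vertex /= xv zv.
have [Dz|[u Evu Dzu]] := IHp _ zv Ep; [left | right; exists u => //];
  exact: connect_trans Dxz _.
Qed.

(** Contrapositive: if all neighbours of v lie in one component of G - v, then [root E] is injective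
    on the representatives of the components of G - v, so deleting v cannot increase their
    number. *)
Lemma articulation_two_neighbours v :
    articulation E v ->
  exists u w, [/\ E v u, E v w & ~~ connect (del_vertex E v) u w].
Proof.
move=> art; set D := del_vertex E v.
have D_sym : connect_sym D by apply/sym_connect_sym/del_vertex_sym.
have E_csym : connect_sym E by apply: sym_connect_sym.
case: (boolP [exists u, exists w, [&& E v u, E v w & ~~ connect D u w]]).
  by case/existsP=> u /existsP[w /and3P[]]; exists u, w.
move=> noD; move: art; rewrite /articulation ltnNge => /negP[].
rewrite /n_comp_mem -(card_in_image (f := root E)) => [|x y].
  by apply: subset_leq_card; apply/subsetP=> _ /imageP[x _ ->];
    rewrite !inE roots_root.
rewrite !inE => /andP[rx xv] /andP[ry yv] rxy.
have cxy : connect E x y by rewrite -root_connect // rxy.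
rewrite -(eqP rx) -(eqP ry); apply/rootP => //.
(* Unless x and y are already joined in G - v, each of them reaches a neighbour of v there, and
   [noD] joins these neighbours. *)
have [//|[u Evu Dxu]] := connect_del_vertexVneighbour xv cxy.
have cyx : connect E y x by rewrite E_csym.
have [|[w Evw Dyw]] := connect_del_vertexVneighbour yv cyx.
  by rewrite D_sym.
apply: connect_trans Dxu _; rewrite D_sym; apply: connect_trans Dyw _.
rewrite D_sym; apply: contraR noD => Duw.
by apply/existsP; exists u; apply/existsP; exists w; rewrite Evu Evw.
Qed.

Lemma path_del_edge_split a b x p :
    path E x p -> ~~ path (del_edge E a b) x p ->
  exists p1 z p2, p = p1 ++ z :: p2 /\ [set last x p1; z] = [set a; b].
Proof.
elim: p x => //= y p IHp x /andP[Exy Ep].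
rewrite {1}/del_edge /= Exy negb_and negbK /=.
case/orP=> [/eqP xy|]; first by exists [::], y, p.
case/(IHp _ Ep)=> p1 [z [p2 [-> eq_e]]].
by exists (y :: p1), z, p2.
Qed.

(** If a simple path used the edge vu, its part on the side of u would avoid v and so join u to an
    end of the path inside G - v. *)
Lemma path_del_edge v u x p :
    v != u -> ~~ connect (del_vertex E v) u x ->
    ~~ connect (del_vertex E v) u (last x p) ->
  path E x p -> uniq (x :: p) -> path (del_edge E v u) x p.
Proof.
have D_sym : connect_sym (del_vertex E v).
  by apply/sym_connect_sym/del_vertex_sym.
move=> vu nx nl Ep Up; apply: contraT => /(path_del_edge_split Ep).
case=> p1 [z [p2 [def_p eq_e]]]; move: Up Ep nl.
rewrite def_p -cat_cons cat_uniq cat_path last_cat /=.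
case/and3P=> _ disj /andP[zp2 _] /and3P[Ep1 _ Ep2] nl.
have {}disj y : y \in z :: p2 -> y \notin x :: p1.
  by apply: (@hasPn _ (mem (x :: p1)) (z :: p2) disj).
have v_in : v \in [set last x p1; z] by rewrite eq_e set21.
have u_in : u \in [set last x p1; z] by rewrite eq_e set22.
(* When v comes first, the tail from u avoids v and reaches the last vertex; when u comes first, the
   initial part from x to u avoids v. *)
case/set2P: v_in => dv; case/set2P: u_in => du.
- by rewrite dv du eqxx in vu.
- case/negP: nl; rewrite du; apply/connectP; exists p2 => //.
  by apply: path_del_vertex => //; apply/negP=> /disj; rewrite dv mem_last.
- case/negP: nx; rewrite D_sym du; apply/connectP; exists p1 => //.
  by apply: path_del_vertex => //; rewrite dv; apply: disj; rewrite mem_head.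
- by rewrite dv du eqxx in vu.
Qed.

End Graph.

Section ShannonGame.
Variables (V : finType) (s t : V) (first : bool) (sigma : seq V -> V).

Lemma follows_rcons h x :
    follows s first sigma h -> (short_turn first (size h) -> x = sigma h) ->
  follows s first sigma (rcons h x).
Proof.
move=> fh hx i; rewrite size_rcons ltnS leq_eqVlt => /orP[/eqP->|lt_ih] turn.
  by rewrite nth_rcons ltnn eqxx -cats1 take_size_cat // hx.
by rewrite nth_rcons lt_ih -cats1 takel_cat ?fh // ltnW.
Qed.

(** Winning is only asserted for complete plays, so a partial history must be prolonged to be
    refuted. On Cut's turns any free vertex will do. *)
Lemma complete_play_extending h :
    legal_strategy s t first sigma -> history s t h ->
    follows s first sigma h ->
  exists p, complete_play s t (h ++ p) /\ follows s first sigma (h ++ p).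
Proof.
move=> legal; have [n] := ubnP (#|V| - size h).
elim: n h => // n IHn h le_n hist_h fol_h.
have [done|undone] := boolP (complete_play s t h).
  by exists [::]; rewrite cats0.
have [x [hist_x fol_x]] : exists x,
    history s t (rcons h x) /\ follows s first sigma (rcons h x).
  have [turn|turn] := boolP (short_turn first (size h)).
    by exists (sigma h); split; [apply: legal | apply: follows_rcons].
  move: undone; rewrite /complete_play hist_h => /forallPn[x].
  rewrite !negb_or => /and3P[xs xt xh]; exists x; split; last first.
    by apply: follows_rcons => //; rewrite (negPf turn).
  case/and3P: hist_h => Uh sh th.
  by rewrite /history rcons_uniq !mem_rcons !inE !negb_or xh Uh sh th
     (eq_sym s) (eq_sym t) xs xt.
have lt_hV : size h < #|V|.
  case/and3P: hist_x => Ux _ _; rewrite -(size_rcons h x) -(card_uniqP Ux).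
  exact: max_card.
have [|p] := IHn (rcons h x) _ hist_x fol_x.
  by rewrite size_rcons; apply: (@leq_trans (#|V| - size h));
     rewrite ?ltn_sub2l.
by rewrite cat_rcons; exists (x :: p).
Qed.

End ShannonGame.

Section Links.
Variables (V : finType) (E : rel V) (s t : V).

(** As v is isolated in [del_vertex E v], the last clause alone would also hold at a terminal when s
    and t differ. The first two clauses make v available to Cut. *)
Definition separates v :=
  [/\ s != v, t != v & ~~ connect (del_vertex E v) s t].

Lemma short_first_two_separators v w :
    v != w -> separates v -> separates w ->
  ~ short_has_winning_strategy E s t true.
Proof.
move=> vw sep_v sep_w [sigma [legal win]].
(* Cut's reply c is a separator that Short's opening move has left free. *)
have [c [sc tc nDc] c_a] : exists2 c, separates c & c != sigma [::].
  by have [<-|] := eqVneq v (sigma [::]); [exists w; rewrite // eq_sym|exists v].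
have hist_a : history s t [:: sigma [::]].
  apply: (legal [::]) => //; rewrite /complete_play negb_and; apply/orP; right.
  by apply/forallPn; exists c; rewrite !negb_or !(eq_sym c) sc tc.
have hist : history s t [:: sigma [::]; c].
  case/and3P: hist_a; rewrite !inE => _ sa ta.
  by rewrite /history /= !inE !negb_or eq_sym c_a sa ta sc tc.
have [|p [done fol]] := complete_play_extending legal hist (first := true).
  by case=> [|[|]].
have [q [Eq _ q_claimed]] := win _ done fol.
case/negP: nDc; apply/connectP; exists (rcons q t); rewrite ?last_rcons //.
apply: path_del_vertex => //; rewrite inE mem_rcons inE
   !negb_or !(eq_sym c) sc tc /=.
(* c has index 1 in the play, which is Cut's turn when Short starts. *)
apply/negP=> /q_claimed; rewrite inE /= (eq_sym _ c) (negPf c_a) eqxx.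
by rewrite andbF.
Qed.

Hypotheses (E_sym : symmetric E) (E_irr : irreflexive E).
Hypothesis min_weak : minimal_weak_link E s t.

(** Legality of plays does not depend on edges, so [sigma] can be kept after deleting vu; were both
    terminals outside the component of u, every winning path would survive, against minimality. *)
Lemma minimal_neighbour_component v u :
  E v u -> connect (del_vertex E v) u s || connect (del_vertex E v) u t.
Proof.
move=> Evu; apply: contraT; rewrite negb_or => /andP[nus nut].
have [[[sigma [legal win]] _] min] := min_weak.
case: (min v u Evu); exists sigma; split=> // p done fol.
have [q [Eq Uq q_claimed]] := win p done fol.
exists q; split=> //; apply: path_del_edge => //; last by rewrite last_rcons.
by apply: contraTneq Evu => ->; rewrite E_irr.
Qed.

Lemma minimal_articulation_separates v : articulation E v -> separates v.
Proof.
have D_sym : connect_sym (del_vertex E v).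
  by apply/sym_connect_sym/del_vertex_sym.
case/(articulation_two_neighbours E_sym)=> u [w [Evu Evw nDuw]].
have neq_v x : E v x -> x != v by apply: contraTneq => ->; rewrite E_irr.
have same x : connect (del_vertex E v) u x ->
    connect (del_vertex E v) w x -> False.
  move=> Dux Dwx; case/negP: nDuw; apply: connect_trans Dux _.
  by rewrite D_sym.
have far x y : connect (del_vertex E v) u x -> connect (del_vertex E v) w y ->
    ~~ connect (del_vertex E v) x y.
  by move=> Dux Dwy; apply/negP=> /(connect_trans Dux) /same; apply.
have nu := connect_del_vertex_neq (neq_v u Evu).
have nw := connect_del_vertex_neq (neq_v w Evw).
(* A terminal common to u and w would connect them in G - v, so they reach different ones; [nu] and
   [nw] show that v is neither. *)
have /orP[us|ut] := minimal_neighbour_component Evu;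
have /orP[ws|wt] := minimal_neighbour_component Evw.
- by case: (same s).
- by split; [apply: nu us | apply: nw wt | apply: far].
- by split; [apply: nw ws | apply: nu ut | rewrite D_sym; apply: far].
- by case: (same t).
Qed.

End Links.

Theorem theorem4 (V : finType) (E : rel V) (E_sym : symmetric E)
    (E_irr : irreflexive E) (s t : V) (s_neq_t : s != t) :
  minimal_weak_link E s t -> #|[set v : V | articulation E v]| <= 1.
Proof.
move=> min; apply/card_le1_eqP => v w; rewrite !inE => art_v art_w.
have [//|vw] := eqVneq w v.
have sep := minimal_articulation_separates E_sym E_irr min.
by case: (short_first_two_separators vw (sep w art_w) (sep v art_v) min.1.1).
Qed.
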